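(* Let $E=\bigsqcup_{n\in\omega}E_n$ be a continuous signature and let $X$ be a semitopological $E$-algebra. If $X$ is a compact space with caliber $\omega_1$ and $E$ is separable, then $X$ is $\mathbb R$-factorizable.
   Context: All spaces are Tychonoff. A continuous signature is a space $E$ that is the disjoint union of clopen (possibly empty) subsets $E_n$, $n\in\omega=\{0,1,2,\dots\}$. An $E$-algebra is a set $X$ with maps $\mathfrak e^X_n\colon E_n\times X^n\to X$, $n\in\omega$ ($X^0$ is a singleton). A semitopological $E$-algebra is an $E$-algebra endowed with a topology such that every $\mathfrak e^X_n$ is separately continuous, i.e. continuous in each of its $n+1$ arguments when the others are fixed. A homomorphism is a map commuting with all operations. A semitopological $E$-algebra $X$ is $\mathbb R$-factorizable if for every continuous $f\colon X\to\mathbb R$ there are a separable metrizable semitopological $E$-algebra $Y$, a continuous function $g\colon Y\to\mathbb R$ and a continuous homomorphism $h\colon X\to Y$ with $f=g\circ h$. A space has caliber $\omega_1$ if every uncountable family of nonempty open sets has an uncountable subfamily with nonempty intersection. *)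

(* Defs.v *)
(* MathComp-Analysis *)
From HB Require Import structures.
From mathcomp Require Import all_boot all_order all_algebra.
From mathcomp Require Import all_classical all_reals all_analysis.

Set Implicit Arguments.
Unset Strict Implicit.
Unset Printing Implicit Defensive.

Import Order.TTheory GRing.Theory Num.Theory.
Import numFieldNormedType.Exports.

Local Open Scope classical_set_scope.
Local Open Scope ring_scope.

(* By [uniform_separatorP], [completely_regular_space] is separation of points
   from closed sets by continuous functions into [0, 1]. *)
Definition tychonoff_space (T : topologicalType) : Prop :=
  accessible_space T /\ completely_regular_space T.

Definition separable_space (T : topologicalType) : Prop :=
  exists2 D : set T, countable D & dense D.

Definition metrizable_space (R : realType) (T : topologicalType) : Prop :=
  exists d : T -> T -> R,
    [/\ forall x y, 0 <= d x y,
        forall x y, d x y = 0 <-> x = y,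
        forall x y, d x y = d y x,
        forall x y z, d x z <= d x y + d y z &
        forall x, nbhs x =
          filter_from [set e : R | 0 < e] (fun e => [set y | d x y < e])].

(* An uncountable indexed family in which only countably many distinct sets occur
   trivially has an uncountable subfamily with nonempty intersection, so it is
   enough to consider families that are sets of open sets. *)
Definition caliber_omega1 (T : topologicalType) : Prop :=
  forall F : set (set T),
    ~ countable F -> (forall U, F U -> open U /\ U !=set0) ->
    exists G : set (set T),
      [/\ G `<=` F, ~ countable G & \bigcap_(U in G) U !=set0].

Definition continuous_signature (E : topologicalType) (E_ : nat -> set E)
    : Prop :=
  [/\ tychonoff_space E, forall n, clopen (E_ n), trivIset setT E_ &
      \bigcup_n E_ n = setT].

(* In [E_ n -> _] the set [E_ n] stands for its subtype, which carries the
   subspace topology. *)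
Definition algebra_on (E : topologicalType) (E_ : nat -> set E) (X : Type)
    : Type :=
  forall n, E_ n -> ('I_n -> X) -> X.

(* [dfwith x i y] is the tuple [x] with its [i]-th entry replaced by [y].
   All spaces under consideration are Tychonoff. *)
Definition semitopological_algebra (E : topologicalType) (E_ : nat -> set E)
    (X : topologicalType) (opX : algebra_on E_ X) : Prop :=
  [/\ tychonoff_space X,
      forall n (x : 'I_n -> X), continuous (fun c : E_ n => opX n c x) &
      forall n (c : E_ n) (x : 'I_n -> X) (i : 'I_n),
        continuous (fun y : X => opX n c (dfwith x i y))].

Definition algebra_hom (E : topologicalType) (E_ : nat -> set E)
    (X Y : Type) (opX : algebra_on E_ X) (opY : algebra_on E_ Y)
    (h : X -> Y) : Prop :=
  forall n (c : E_ n) (x : 'I_n -> X), h (opX n c x) = opY n c (h \o x).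

Definition R_factorizable (R : realType) (E : topologicalType)
    (E_ : nat -> set E) (X : topologicalType) (opX : algebra_on E_ X) : Prop :=
  forall f : X -> R, continuous f ->
  exists (Y : topologicalType) (opY : algebra_on E_ Y)
         (g : Y -> R) (h : X -> Y),
    [/\ semitopological_algebra opY, separable_space Y & metrizable_space R Y]
    /\ [/\ continuous g, continuous h, algebra_hom opX opY h & f = g \o h].

(* Main.v *)
Require Import Defs.
From HB Require Import structures.
From mathcomp Require Import all_boot all_order all_algebra.
From mathcomp Require Import all_classical all_reals all_analysis.
From mathcomp Require Import lra.

(* The space Y is the image of X under a countable family F of continuous
   functions containing f, and F has to be such that the operations respect the
   equivalence "no member of F distinguishes u and u'". For this it suffices
   that, given a separately continuous g on X^n and a coordinate i, countably
   many sections u |-> g (y with u in the place i) separate all points that are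
   separated by some section.

   This is shown by induction on the number of coordinates other than i. If no
   countable set A of entries of y is enough, every countable S has a pair
   u_S, u'_S that no section over S separates, although the section over some
   y_S does. Let S run over an omega_1-like chain of countable sets closed under
   witnesses, and let M be its union. By caliber omega_1 one p can replace the
   j-th entry of y_S for uncountably many S. By compactness and induction p may
   be moved into the closure of M without changing the sections at points of M.
   By induction countably many sections with j-th entry p determine the others,
   and by countable tightness these are pointwise limits of sections with j-th
   entry in one S_0 of the chain. But those do not separate u_S and u'_S once S
   is beyond S_0. *)

Set Implicit Arguments.
Unset Strict Implicit.
Unset Printing Implicit Defensive.

Import Order.TTheory GRing.Theory Num.Theory.
Import numFieldNormedType.Exports.

Local Open Scope classical_set_scope.
Local Open Scope ring_scope.

(** * Countable sets and caliber *)

Lemma sub_countable_set (T : Type) (A B : set T) :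
  A `<=` B -> countable B -> countable A.
Proof. by move=> AB; apply/sub_countable/subset_card_le. Qed.

Lemma countable_image (T U : Type) (f : T -> U) (A : set T) :
  countable A -> countable (f @` A).
Proof. exact/sub_countable/card_image_le. Qed.

Lemma countable_setU (T : Type) (A B : set T) :
  countable A -> countable B -> countable (A `|` B).
Proof.
move=> cA cB; have -> : A `|` B = \bigcup_(b in setT) if b then A else B.
  apply/seteqP; split => x; first by case=> ?; [exists true|exists false].
  by case; case=> _ ?; [left|right].
by apply: bigcup_countable => //; case.
Qed.

Lemma countable_enumeration (T : Type) (A : set T) (a : T) :
  countable A -> A a -> exists f : nat -> T, range f = A.
Proof.
move=> /pfcard_geP[->//|[f]] _; exists f; apply/seteqP; split.
  by move=> _ [n _ <-]; exact: funS.
by move=> x /(@surj _ _ _ _ f)[n _ <-]; exists n.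
Qed.

(* A maximal chain for the relation [Phi S `<=` S'] behaves like omega_1: it has
   countable initial segments, because a point of [Phi S] outside [S] determines
   [S], and no countable cofinal subset, by maximality. *)
Lemma chain_of_countable_sets (T : Type) (Phi : set T -> set T) :
  (forall S, countable S -> countable (Phi S)) ->
  (forall S, countable S -> S `<` Phi S) ->
  exists C : set (set T), [/\ ~ countable C,
    forall S, C S -> countable S,
    forall D, D `<=` C -> countable D ->
      exists2 S, C S & forall S', D S' -> Phi S' `<=` S &
    forall G S, G `<=` C -> ~ countable G -> C S ->
      exists2 S', G S' & Phi S `<=` S'].
Proof.
move=> cPhi sPhi.
(* Distinct members of a chain for [before] are comparable strongly: one contains all of [Phi] of
   the other. *)
pose before S S' := S = S' \/ Phi S `<=` S' \/ Phi S' `<=` S.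
pose P (C : set (set T)) := (forall S, C S -> countable S) /\
  (forall S S', C S -> C S' -> before S S').
have [C [[cC tC] maxC]] : exists C, P C /\ forall D, C `<` D -> ~ P D.
  apply: Zorn_bigcup => F FP tF; split.
    by move=> S [C FC CS]; have [+ _] := FP _ FC; exact.
  move=> S S' [C FC CS] [C' FC' CS'].
  have [CC'|C'C] := tF _ _ FC FC'.
    by have [_] := FP _ FC'; apply => //; exact: CC'.
  by have [_] := FP _ FC; apply => //; exact: C'C.
have dirC D : D `<=` C -> countable D ->
    exists2 S, C S & forall S', D S' -> Phi S' `<=` S.
  (* Otherwise the countable union [U] contains [Phi S] for every [S] in [C], so that [Phi U] can be
     added to [C], against maximality. *)
  move=> DC cD; apply: contrapT => noS.
  pose U := \bigcup_(S in D) Phi S; pose V := Phi U.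
  have cU : countable U.
    by apply: bigcup_countable => // S DS; exact/cPhi/cC/DC.
  have UV : U `<` V by exact: sPhi.
  have CU S : C S -> Phi S `<=` U.
    move=> CS; apply: contrapT => nSU; apply: noS; exists S => // S' DS'.
    have [eSS'|[//|S'S]] := tC _ _ (DC _ DS') CS.
      by exfalso; apply: nSU; rewrite -eSS' => x ?; exists S'.
    exfalso; apply: nSU => x /S'S S'x; exists S' => //.
    by have [+ _] := sPhi _ (cC _ (DC _ DS')); exact.
  apply: (maxC (C `|` [set V])).
    split; first by left.
    move=> /(_ V (or_intror erefl)) CV; have := CU _ CV.
    move=> VU; have [VV _] := sPhi _ (cC _ CV).
    by apply: UV.2; exact: subset_trans VU.
  split.
    by move=> S [/cC//|->]; exact: cPhi.
  move=> S S' [CS|->] [CS'|->]; first exact: tC.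
  - by right; left; apply: subset_trans UV.1; exact: CU.
  - by right; right; apply: subset_trans UV.1; exact: CU.
  - by left.
exists C; split => //.
  move=> ccC; have [S CS] := dirC _ (@subset_refl _ C) ccC.
  by move=> /(_ _ CS) SS; case: (sPhi _ (cC _ CS)).
move=> G S GC ncG CS; apply: contrapT => noS'; apply: ncG.
have GS S' : G S' -> S' = S \/ Phi S' `<=` S.
  move=> GS'; have [|[|SS']] := tC _ _ (GC _ GS') CS; [by left|by right|].
  by exfalso; apply: noS'; exists S'.
have /choice[w wP] : forall S', exists x, G S' -> Phi S' x /\ ~ S' x.
  move=> S'; have [GS'|nGS'] := pselect (G S').
    have [_ /existsNP[x /not_implyP[? ?]]] := sPhi _ (cC _ (GC _ GS')).
    by exists x.
  have [_ /existsNP[x _]] := sPhi _ (cC _ CS).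
  by exists x.
apply: (@sub_countable_set _ _ ([set S] `|` [set S' | G S' /\ Phi S' `<=` S])).
  by move=> S' GS'; have [->|] := GS _ GS'; [left|right].
apply: countable_setU; first exact: countable1.
have /countable_injP[f finj] := cC _ CS.
apply/countable_injP; exists (f \o w) => S1 S2 /set_mem[G1 S1S] /set_mem[G2 S2S].
have [P1 N1] := wP _ G1; have [P2 N2] := wP _ G2.
move=> /finj; rewrite !inE => /(_ (S1S _ P1) (S2S _ P2)) w12.
have [//|[S12|S21]] := tC _ _ (GC _ G1) (GC _ G2).
  by exfalso; apply: N2; rewrite -w12; exact: S12.
by exfalso; apply: N1; rewrite w12; exact: S21.
Qed.

(** If the [U i] take only countably many values, one of them is taken uncountably often and any of
    its points serves. Otherwise the caliber applies to the set of values. *)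
Lemma caliber_omega1_family (T : topologicalType) (I : Type) (A : set I)
    (U : I -> set T) : caliber_omega1 T -> ~ countable A ->
  (forall i, A i -> open (U i) /\ U i !=set0) ->
  exists B p, [/\ B `<=` A, ~ countable B & forall i, B i -> U i p].
Proof.
move=> cal ncA AU; have [cUA|ncUA] := pselect (countable (U @` A)).
  have [i [Ai nci]] : exists i, A i /\ ~ countable (A `&` [set j | U j = U i]).
    apply: contrapT => /forallNP no; apply: ncA.
    apply: (@sub_countable_set _ _
      (\bigcup_(V in U @` A) (A `&` [set j | U j = V]))).
      by move=> i Ai; exists (U i) => //; exists i.
    apply: bigcup_countable => // _ [i Ai <-].
    by apply: contrapT => nci; apply: (no i).
  have [_ [p Up]] := AU _ Ai.
  by exists (A `&` [set j | U j = U i]), p; split => // j [_ ->].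
have [|G [GF ncG [p Gp]]] := cal _ ncUA; first by move=> _ [i Ai <-]; exact: AU.
exists (A `&` [set i | G (U i)]), p; split => //; last first.
  by move=> i [_ GUi]; exact: Gp.
move=> cB; apply: ncG; apply: sub_countable_set (countable_image U cB).
by move=> V GV; have [i Ai UiV] := GF _ GV; exists i => //; split; rewrite //= UiV.
Qed.

(** * Continuous functions on compact spaces *)

(** The image of [T] in a countable power of the line is separable: choose one point for each
    rational box that meets the image. *)
Lemma approximating_countable_set (R : realType) (T : Type)
    (H : nat -> T -> R) :
  exists2 D : set T, countable D &
    forall p n (e : R), 0 < e ->
      exists2 d, D d & forall k, (k < n)%N -> `|H k d - H k p| < e.
Proof.
pose A (q : seq rat * nat) (p : T) := forall k, (k < size q.1)%N ->
  `|H k p - ratr (nth 0%Q q.1 k)| < q.2.+1%:R^-1.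
have /choice[w wP] : forall q, exists o : option T, forall p, A q p ->
    exists2 d, o = Some d & A q d.
  move=> q; have [[d Ad]|noA] := pselect (exists d, A q d).
    by exists (Some d) => p _; exists d.
  by exists None => p Ap; exfalso; apply: noA; exists p.
exists (\bigcup_(q in setT) [set d | w q = Some d]).
  apply: bigcup_countable => [|q _]; first exact: countableP.
  apply/countable_injP; exists (fun=> 0%N) => x y /set_mem/= wx /set_mem/=.
  by rewrite wx => -[].
move=> p n e e0.
have [m me] : exists m : nat, m.+1%:R^-1 < e / 2.
  have e20 : 0 < e / 2 by rewrite divr_gt0.
  exists (Num.truncn (e / 2)^-1); rewrite invf_plt ?posrE//.
  by rewrite truncnS_gt.
have /choice[q qP] : forall k, exists q : rat,
    `|H k p - ratr q| < m.+1%:R^-1.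
  move=> k; have r0 : 0 < m.+1%:R^-1 :> R by rewrite invr_gt0.
  move: (m.+1%:R^-1) r0 => r r0.
  have : H k p - r < H k p + r by rewrite ltrD2l gtrN.
  move=> /rat_in_itvoo[q]; rewrite in_itv/= => /andP[q1 q2].
  by exists q; rewrite ltr_norml; apply/andP; split; lra.
have Ap : A (mkseq q n, m) p.
  by move=> k /=; rewrite size_mkseq => kn; rewrite nth_mkseq.
have [d wd Ad] := wP _ _ Ap; exists d; first by exists (mkseq q n, m).
move=> k kn; have := Ap k; have := Ad k; rewrite /= size_mkseq nth_mkseq//.
move=> /(_ kn) + /(_ kn).
move: (m.+1%:R^-1) me => r re; rewrite !ltr_norml => /andP[a1 a2] /andP[b1 b2].
by apply/andP; split; lra.
Qed.

Lemma compact_directed_nonempty (T : topologicalType) (I : Type) (A : set I)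
    (K : I -> set T) : compact [set: T] -> A !=set0 ->
  (forall i, A i -> closed (K i) /\ K i !=set0) ->
  (forall i j, A i -> A j -> exists2 k, A k & K k `<=` K i `&` K j) ->
  exists p, forall i, A i -> K i p.
Proof.
move=> cT A0 AK dirK.
have FF : ProperFilter (filter_from A K).
  by apply: filter_from_proper => [|i /AK[]//]; exact: filter_from_filter.
have [p [_ clp]] := cT _ FF filterT.
exists p => i Ai; have [cK _] := AK _ Ai; apply: cK => B Bp.
by apply: clp => //; exists i.
Qed.

(** Points of an approximating set match [p] on finitely many members of [H] up to any error.
    Compactness turns them into one point of the closure that matches exactly on all of [H]. *)
Lemma reflecting_countable_set (R : realType) (T : topologicalType)
    (H : set (T -> R)) : compact [set: T] -> countable H ->
  (forall h, H h -> continuous h) ->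
  exists2 D : set T, countable D &
    forall p, exists2 p', closure D p' & forall h, H h -> h p' = h p.
Proof.
move=> cT cH contH.
have [[h0 Hh0]|noH] := pselect (exists h, H h); last first.
  have [[t _]|noT] := pselect (exists t : T, True).
    exists [set t]; first exact: countable1.
    move=> p; exists t; first exact: subset_closure.
    by move=> h Hh; exfalso; apply: noH; exists h.
  by exists set0; [exact: countable0|move=> p; exfalso; apply: noT; exists p].
have [h hH] := countable_enumeration cH Hh0.
have conth k : continuous (h k) by apply: contH; rewrite -hH; exists k.
have [D cD DP] := approximating_countable_set h.
exists D => // p.
pose B n k : set T := (fun s => `|h k s - h k p|) @^-1` [set r | r <= n.+1%:R^-1].
have [] := @compact_directed_nonempty T nat setT
  (fun n => closure D `&` \bigcap_(k in `I_n) B n k) cT.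
- by exists 0%N.
- move=> n _; split.
    apply: closedI; first exact: closed_closure.
    apply: closed_bigI => k _; apply: closed_comp; last exact: closed_le.
    move=> s _; apply: (@cvg_norm _ _ _ (nbhs s)).
    by apply: cvgB; [exact: (conth k s)|exact: cvg_cst].
  have [|d Dd dP] := DP p n n.+1%:R^-1; first by rewrite invr_gt0.
  exists d; split; first exact: subset_closure.
  by move=> k /= kn; apply/ltW/dP.
- move=> i j _ _; exists (maxn i j) => // s [Ds sB].
  have leV (a b : nat) : (a <= b)%N -> b.+1%:R^-1 <= a.+1%:R^-1 :> R.
    by move=> ab; rewrite lef_pV2 ?posrE// ler_nat ltnS.
  split; split => // k /= ki.
    apply: le_trans (leV _ _ (leq_maxl i j)).
    by apply: sB => /=; rewrite leq_max ki.
  apply: le_trans (leV _ _ (leq_maxr i j)).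
  by apply: sB => /=; rewrite leq_max ki orbT.
move=> p' p'P; exists p'; first by have [] := p'P 0%N I.
move=> h'; rewrite -hH => -[k _ <-].
apply/eqP; rewrite -subr_eq0 -normr_le0; apply/ler_addgt0Pl => e e0; rewrite addr0.
have [_ /(_ k)] := p'P (maxn k.+1 (Num.truncn e^-1)) I.
rewrite /B/= leq_max ltnSn => /(_ isT) /le_trans; apply.
rewrite invf_ple ?posrE//; apply: le_trans (ltW (truncnS_gt _)) _.
by rewrite ler_nat ltnS leq_maxr.
Qed.

(* Grothendieck: a compact family of continuous functions on a compact space
   has countable tightness in the topology of pointwise convergence. *)
Lemma countable_tightness (R : realType) (T U : topologicalType) (M : set T) (p : T)
    (phi : T -> U -> R) : compact [set: U] ->
  (forall v, continuous (phi^~ v)) -> (forall c, continuous (phi c)) ->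
  closure M p ->
  exists C : set T, [/\ countable C, C `<=` M &
    forall v v', (forall c, C c -> phi c v = phi c v') -> phi p v = phi p v'].
Proof.
move=> cU phi1 phi2 Mp.
(* A single [c] has to approximate [p] at [v] and [v'] at once, so that equality at the two points
   passes to [p]; hence the compactness of [U * U]. *)
have /choice[C CP] : forall n : nat, exists C : set T, [/\ countable C, C `<=` M &
    forall vv : U * U, exists2 c, C c &
      `|phi c vv.1 - phi p vv.1| < n.+1%:R^-1 /\
      `|phi c vv.2 - phi p vv.2| < n.+1%:R^-1].
  move=> n; have e0 : 0 < n.+1%:R^-1 :> R by rewrite invr_gt0.
  (* Along [F] a property is eventual if it holds for all supersets of some countable subset of [M].
     Compactness thus merges the local choices of [c] into one countable set. *)
  pose F : set_system (set T) := filter_from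
    [set C | countable C /\ C `<=` M] (fun C => [set C' | C `<=` C']).
  have FF : Filter F.
    apply: filter_from_filter => [|C1 C2 [c1 s1] [c2 s2]].
      by exists set0; split; [exact: countable0|].
    exists (C1 `|` C2); first split; [exact: countable_setU| |].
      by move=> x [/s1|/s2].
    by move=> C' /= sC'; split=> x ?; apply: sC'; [left|right].
  pose Q (C : set T) (vv : U * U) := exists2 c, C c &
      `|phi c vv.1 - phi p vv.1| < n.+1%:R^-1 /\
      `|phi c vv.2 - phi p vv.2| < n.+1%:R^-1.
  have : compact [set: U * U].
    by rewrite -setXTT; exact: compact_setX.
  move=> /compact_near_coveringP /(_ _ F Q FF)[].
    move=> [v v'] _.
    have [c [Mc [c1 c2]]] : M `&` [set c | `|phi c v - phi p v| < n.+1%:R^-1 /\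
                   `|phi c v' - phi p v'| < n.+1%:R^-1] !=set0.
      apply: Mp; near=> c; split; near: c.
        by have /cvgrPdistC_lt := phi1 v p; apply.
      by have /cvgrPdistC_lt := phi1 v' p; apply.
    have contd : continuous (fun x => `|phi c x - phi p x|).
      move=> x; apply: (@cvg_norm _ _ _ (nbhs x)).
      by apply: cvgB; [exact: (phi2 c x)|exact: (phi2 p x)].
    have near1 x : `|phi c x - phi p x| < n.+1%:R^-1 ->
        \forall y \near x, `|phi c y - phi p y| < n.+1%:R^-1.
      by move=> cx; exact: (cvgr_lt _ (contd x)).
    exists ([set vv | `|phi c vv.1 - phi p vv.1| < n.+1%:R^-1 /\
         `|phi c vv.2 - phi p vv.2| < n.+1%:R^-1], [set C | C c]).
      split => /=.
        exists ([set y | `|phi c y - phi p y| < n.+1%:R^-1],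
                [set y | `|phi c y - phi p y| < n.+1%:R^-1]) => //=.
        by split; exact: near1.
      exists [set c]; first by split; [exact: countable1|move=> _ ->].
      by move=> C' /=; apply.
    by move=> [vv C'] [/= ? ?]; exists c.
  move=> C0 [cC0 sC0] CQ; exists C0; split => // vv.
  exact: (CQ C0 (@subset_refl _ _) vv I).
exists (\bigcup_n C n); split.
- by apply: bigcup_countable => // n _; have [] := CP n.
- by move=> c [n _ Cc]; have [_ + _] := CP n; apply.
move=> v v' vv'; apply/eqP; rewrite -subr_eq0 -normr_le0.
apply/ler_addgt0Pl => e e0; rewrite addr0.
have [_ _ /(_ (v, v'))[c Cc /= [c1 c2]]] := CP (Num.truncn (e / 2)^-1).
have ce : (Num.truncn (e / 2)^-1).+1%:R^-1 < e / 2.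
  by rewrite invf_plt ?posrE ?divr_gt0// truncnS_gt.
have := vv' c (ex_intro2 _ _ _ I Cc).
move: (_.+1%:R^-1) ce c1 c2 => r re.
rewrite !ltr_norml ler_norml => /andP[? ?] /andP[? ?] ?.
by apply/andP; split; lra.
Unshelve. all: by end_near. Qed.

(** * Separately continuous functions of several variables *)

Section DfwithAlgebra.
Variables (I : eqType) (T : Type).
Implicit Types (x y : I -> T) (i j : I) (u v : T).

Lemma dfwithC x i j u v : i != j ->
  dfwith (dfwith x i u) j v = dfwith (dfwith x j v) i u.
Proof.
move=> ij; apply/funext => k; have [->|kj] := eqVneq k j.
  by rewrite dfwithin dfwithout// dfwithin.
rewrite dfwithout 1?eq_sym//; have [->|ki] := eqVneq k i; first by rewrite !dfwithin.
by rewrite !dfwithout// eq_sym.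
Qed.

Lemma dfwith_dfwith x i u v : dfwith (dfwith x i u) i v = dfwith x i v.
Proof.
apply/funext => k; have [->|ki] := eqVneq k i; first by rewrite !dfwithin.
by rewrite !dfwithout// eq_sym.
Qed.

Lemma dfwith_id x i : dfwith x i (x i) = x.
Proof.
apply/funext => k; have [->|ki] := eqVneq k i; first by rewrite dfwithin.
by rewrite dfwithout// eq_sym.
Qed.

End DfwithAlgebra.

Definition tuples_in (I : eqType) (T : Type) (J : seq I) (x : I -> T) (A : set T) :
    set (I -> T) :=
  [set y | (forall k, k \notin J -> y k = x k) /\ (forall k, k \in J -> A (y k))].

Lemma countable_tuples_in (I : eqType) (T : Type) (J : seq I) (x : I -> T)
  (A : set T) : uniq J -> countable A -> countable (tuples_in J x A).
Proof.
move=> + cA; elim: J => [_|j J IH /= /andP[jJ uJ]].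
  apply: sub_countable_set (countable1 x) => y [yx _].
  by apply/funext => k; exact: yx.
apply: (@sub_countable_set _ _
  (\bigcup_(a in A) ((fun y => dfwith y j a) @` tuples_in J x A))).
  move=> y [yx yA]; exists (y j); first by apply: yA; rewrite inE eqxx.
  exists (dfwith y j (x j)); last by rewrite dfwith_dfwith dfwith_id.
  split=> k kJ; have [kj|kj] := eqVneq k j.
  - by rewrite kj dfwithin.
  - by rewrite dfwithout 1?eq_sym// yx// inE negb_or kj.
  - by rewrite kj (negPf jJ) in kJ.
  - by rewrite dfwithout 1?eq_sym//; apply: yA; rewrite inE kJ orbT.
apply: bigcup_countable => // a _; exact/countable_image/IH.
Qed.

Lemma tuples_inS (I : eqType) (T : Type) (J : seq I) (x : I -> T)
  (A B : set T) : A `<=` B -> tuples_in J x A `<=` tuples_in J x B.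
Proof. by move=> AB y [yx yA]; split=> // k /yA/AB. Qed.

(* Only the entries of [x] outside [i :: J] matter. *)
Definition determining (I : eqType) (T S : Type) (g : (I -> T) -> S)
    (J : seq I) (i : I) (x : I -> T) (A : set T) : Prop :=
  forall u u', (forall y, tuples_in J x A y ->
      g (dfwith y i u) = g (dfwith y i u')) ->
    forall y, tuples_in J x setT y -> g (dfwith y i u) = g (dfwith y i u').

Section DeterminingStep.
Variables (R : realType) (X : topologicalType).
Hypotheses (cptX : compact [set: X]) (cal : caliber_omega1 X).
Variables (I : eqType) (g : (I -> X) -> R).
Hypothesis contg : forall y i, continuous (fun u => g (dfwith y i u)).
Variables (J : seq I) (i j : I) (x : I -> X).
Hypotheses (iJ : i \notin J) (jJ : j \notin J) (ij : i != j) (uJ : uniq J).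
Hypothesis IHi : forall x, exists2 A, countable A & determining g J i x A.
Hypothesis IHj : forall x, exists2 A, countable A & determining g J j x A.

Lemma determining_cons : exists2 A, countable A & determining g (j :: J) i x A.
Proof.
apply: contrapT => noA.
have ji : j != i by rewrite eq_sym.
(* [w S] consists of u_S, u'_S and y_S; its value at an uncountable [S] is a dummy. *)
have /choice[w wP] : forall S : set X, exists w : X * X * (I -> X), countable S ->
    [/\ forall y, tuples_in (j :: J) x S y ->
          g (dfwith y i w.1.1) = g (dfwith y i w.1.2),
        tuples_in (j :: J) x setT w.2 &
        g (dfwith w.2 i w.1.1) <> g (dfwith w.2 i w.1.2)].
  move=> S; have [cS|ncS] := pselect (countable S); last first.
    by exists (x i, x i, x) => /ncS.
  have : ~ determining g (j :: J) i x S by move=> dS; apply: noA; exists S.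
  move=> /existsNP[u] /existsNP[u'] /not_implyP[uu'] /existsNP[y] /not_implyP[yx ne].
  by exists (u, u', y).
have /choice[A1 A1P] : forall a, exists A, countable A /\
    determining g J i (dfwith x j a) A.
  by move=> a; have [A cA dA] := IHi (dfwith x j a); exists A.
have /choice[A2 A2P] : forall a, exists A, countable A /\
    determining g J j (dfwith x i a) A.
  by move=> a; have [A cA dA] := IHj (dfwith x i a); exists A.
(* [H S] collects the sections in the [j]-th variable whose entries at [i] and on [J] lie in [S]. *)
pose Y (S : set X) := \bigcup_(a in S) tuples_in J (dfwith x i a) S.
pose H (S : set X) : set (X -> R) := (fun y u => g (dfwith y j u)) @` Y S.

have contH S h : H S h -> continuous h by move=> [y _ <-]; exact: contg.
have cH S : countable S -> countable (H S).
  move=> cS; apply/countable_image/bigcup_countable => // a _.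
  exact: countable_tuples_in.
have /choice[D DP] : forall S : set X, exists D : set X, countable S ->
    countable D /\
    forall p, exists2 p', closure D p' & forall h, H S h -> h p' = h p.
  move=> S; have [cS|ncS] := pselect (countable S); last by exists set0 => /ncS.
  by have [D cD DP] := reflecting_countable_set cptX (cH _ cS) (@contH S); exists D.
(* The entries of y_S make [Phi S] strictly larger than [S]: if they all lay in [S], y_S could not
   separate its pair. *)
pose Phi S := S `|` [set (w S).1.1; (w S).1.2] `|` ((w S).2 @` [set` j :: J])
  `|` \bigcup_(a in S) A1 a `|` \bigcup_(a in S) A2 a `|` D S.
have PhiS S : S `<=` Phi S by move=> a Sa; do 5 left.
have Phiu S : Phi S (w S).1.1 by do 4 left; right; left.
have Phiu' S : Phi S (w S).1.2 by do 4 left; right; right.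
have PhiA1 S a : S a -> A1 a `<=` Phi S.
  by move=> Sa b A1b; do 2 left; right; exists a.
have PhiA2 S a : S a -> A2 a `<=` Phi S by move=> Sa b A2b; left; right; exists a.
have PhiD S : D S `<=` Phi S by move=> a Da; right.
have cPhi S : countable S -> countable (Phi S).
  move=> cS; rewrite /Phi; do !apply: countable_setU => //.
  - exact/countable_image/finite_set_countable/finite_seq.
  - by apply: bigcup_countable => // a _; have [] := A1P a.
  - by apply: bigcup_countable => // a _; have [] := A2P a.
  - by have [] := DP _ cS.
have sPhi S : countable S -> S `<` Phi S.
  move=> cS; split; first exact: PhiS.
  move=> PhiSS; have [wS [wx _] []] := wP _ cS.
  apply: wS; split => // k kJ; apply: PhiSS.
  by do 3 left; right; exists k.
have [C [ncC cC dirC cofC]] := chain_of_countable_sets cPhi sPhi.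
(* These are the [j]-th entries with which y_S still separates its pair; its own [j]-th entry is one
   of them. *)
pose U S : set X := [set p | g (dfwith (dfwith (w S).2 j p) i (w S).1.1) !=
                    g (dfwith (dfwith (w S).2 j p) i (w S).1.2)].
have [|G [p [GC ncG Up]]] := @caliber_omega1_family X _ C U cal ncC.
  move=> S CS; have [_ wx /eqP ne] := wP _ (cC _ CS); split; last first.
    by exists ((w S).2 j); rewrite /U/= dfwith_id.
  rewrite (_ : U S = (fun p => g (dfwith (dfwith (w S).2 i (w S).1.1) j p) -
      g (dfwith (dfwith (w S).2 i (w S).1.2) j p)) @^-1` [set r | r != 0]).
    apply: open_comp; last exact: open_neq.
    by move=> q _; apply: cvgB; exact: contg.
  by apply/seteqP; split => q /=; rewrite subr_eq0 !(dfwithC _ _ _ ij).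
pose M := \bigcup_(S in C) S.
have succ S : C S -> exists2 S', C S' & Phi S `<=` S'.
  move=> CS; have [] := dirC [set S] _ (countable1 _); first by move=> _ ->.
  by move=> S' CS' SS'; exists S' => //; exact: SS'.
have PhiM S : C S -> Phi S `<=` M.
  by move=> /succ[S' CS' SS'] a /SS' S'a; exists S'.
have HS (S S' : set X) : S `<=` S' -> H S `<=` H S'.
  move=> SS' _ [y [a Sa ya] <-]; exists y => //; exists a; first exact: SS'.
  exact: tuples_inS ya.
(* For each [S] the closure of [D S] provides a substitute for [p]. The conditions are directed
   because [C] is and [H] is monotone, so compactness gives one [p'] for all [S]. *)
have [p' p'P] : exists p', forall S, C S ->
    (closure M `&` [set s | forall h, H S h -> h s = h p]) p'.
  apply: compact_directed_nonempty => //.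
  - apply: contrapT => C0; apply: ncC; rewrite (_ : C = set0); first exact: countable0.
    by apply/seteqP; split => // S CS; case: C0; exists S.
  - move=> S CS; split.
      apply: closedI; first exact: closed_closure.
      rewrite (_ : mkset _ = \bigcap_(h in H S) (h @^-1` [set h p])); last first.
        by apply/seteqP; split => s sH h Hh; exact: sH.
      apply: closed_bigI => h Hh; apply: closed_comp; last exact: closed_eq.
      by move=> s _; exact: contH Hh s.
    have [_ /(_ p)[s Ds sp]] := DP _ (cC _ CS); exists s; split => //.
    by apply: closure_subset Ds; apply: subset_trans (PhiM _ CS); exact: PhiD.
  - move=> S1 S2 C1 C2; have [] := dirC [set S1; S2].
    + by move=> _ [] ->.
    + by apply: countable_setU; exact: countable1.
    move=> S CS SP; exists S => // s [Ms sp].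
    split; split => // h Hh; apply: sp; apply: HS Hh.
      by apply: subset_trans (PhiS _) (SP _ _); left.
    by apply: subset_trans (PhiS _) (SP _ _); right.
have [S0 CS0] : exists S, C S.
  apply: contrapT => C0; apply: ncC; rewrite (_ : C = set0); first exact: countable0.
  by apply/seteqP; split => // S CS; case: C0; exists S.
have clp' : closure M p' by have [] := p'P _ CS0.
(* For [a] in [M] the sections in the [j]-th variable with [i]-th entry [a] are
   determined by their values at entries from [M]. *)
have pp' a y : M a -> tuples_in (j :: J) x setT y ->
    g (dfwith (dfwith y j p) i a) = g (dfwith (dfwith y j p') i a).
  move=> [S1 CS1 S1a] [yx _]; have [S2 CS2 S12] := succ _ CS1.
  have [cA2 dA2] := A2P a.
  have := dA2 p p' _ (dfwith (dfwith y j (x j)) i a).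
  rewrite !(dfwithC _ _ _ ij) !(dfwithC _ _ _ ji) !dfwith_dfwith; apply.
    move=> z za; have [_ /(_ (fun u => g (dfwith z j u)))/=] := p'P _ CS2.
    move=> -> //; exists z => //; exists a; first exact/S12/PhiS.
    by apply: tuples_inS za => b A2b; exact/S12/(PhiA2 _ _ S1a).
  split => // k kJ; have [->|kj] := eqVneq k j.
    by rewrite dfwithin dfwithout.
  rewrite dfwithout 1?eq_sym//; have [->|ki] := eqVneq k i; first by rewrite !dfwithin.
  by rewrite !dfwithout 1?eq_sym//; apply: yx; rewrite inE negb_or kj.
(* With [j]-th entry [p'] the countably many tuples [Ts] suffice. By tightness each needs only
   countably many entries [c] from [M], so some [S1] in the chain contains all of these. *)
have [A3 cA3 dA3] := IHi (dfwith x j p').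
pose Ts := tuples_in J (dfwith x j p') A3.
have cTs : countable Ts by exact: countable_tuples_in.
have /choice[K KP] : forall y : I -> X, exists K : set X, [/\ countable K, K `<=` M &
    forall v v', (forall c, K c ->
      g (dfwith (dfwith y j c) i v) = g (dfwith (dfwith y j c) i v')) ->
      g (dfwith (dfwith y j p') i v) = g (dfwith (dfwith y j p') i v')].
  move=> y; apply: (countable_tightness
    (phi := fun c v => g (dfwith (dfwith y j c) i v)) cptX) => //.
  move=> v; rewrite (_ : (fun c => _) = fun c => g (dfwith (dfwith y i v) j c)).
    exact: contg.
  by apply/funext => c; rewrite dfwithC.
have /choice[s sP] : forall c, exists S, M c -> C S /\ S c.
  move=> c; have [[S CS Sc]|nMc] := pselect (M c); first by exists S.
  by exists set0.
have [S1 CS1 S1P] : exists2 S, C S & forall y, Ts y -> K y `<=` S.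
  pose KK := \bigcup_(y in Ts) K y.
  have KM : KK `<=` M by move=> c [y _ Kc]; have [_ + _] := KP y; apply.
  have [| |S CS SP] := dirC (s @` KK).
  - by move=> _ [c /KM/sP[Cs _] <-].
  - apply/countable_image/bigcup_countable => // y _.
    by have [] := KP y.
  exists S => // y Ty c Kc; have KKc : KK c by exists y.
  apply: (SP (s c)); first by exists c.
  by apply: PhiS; have [] := sP _ (KM _ KKc).
(* This [S] contains [S1] and [A1 c] for every [c] in [S1], so its pair is not separated by any
   section with [j]-th entry in [S1]. *)
have [S GS S1S] := cofC G S1 GC ncG CS1.
have CS := GC _ GS.
have [wS [wx _] _] := wP _ (cC _ CS).
have eqS1 c y : S1 c -> tuples_in J (dfwith x j c) setT y ->
    g (dfwith y i (w S).1.1) = g (dfwith y i (w S).1.2).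
  move=> S1c; have [_ dA1] := A1P c; apply: dA1 => z [zx zA]; apply: wS.
  split=> k; rewrite inE.
    rewrite negb_or => /andP[kj kJ]; rewrite zx// dfwithout//.
    by rewrite eq_sym.
  move=> /predU1P[->|kJ]; last exact/S1S/(PhiA1 _ _ S1c)/zA.
  by rewrite zx// dfwithin; exact/S1S/PhiS.
(* Tightness carries the equality from the entries in [K y] to [p'] for [y] in [Ts], and [dA3]
   extends it to all tuples. *)
have eqp' y : tuples_in J (dfwith x j p') setT y ->
    g (dfwith y i (w S).1.1) = g (dfwith y i (w S).1.2).
  apply: dA3 => {}y Ty; have [yx yA] := Ty.
  have yj : y j = p' by rewrite yx// dfwithin.
  have [_ _ /(_ (w S).1.1 (w S).1.2)] := KP y.
  rewrite -yj dfwith_id; apply => c Kc; apply: (eqS1 c); first exact: S1P Kc.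
  split=> // k kJ; have [->|kj] := eqVneq k j; first by rewrite !dfwithin.
  by rewrite dfwithout 1?eq_sym// yx// !dfwithout 1?eq_sym.
(* With [j]-th entry [p] the tuple y_S separates its pair. Both points of the pair lie in [M], so
   [p] may be replaced by [p'], where this is impossible. *)
have := Up _ GS; rewrite /U/= => /eqP; apply.
have uM : M (w S).1.1 by exact: PhiM (Phiu S).
have u'M : M (w S).1.2 by exact: PhiM (Phiu' S).
rewrite !pp'//; apply: eqp'; split=> // k kJ.
have [->|kj] := eqVneq k j; first by rewrite !dfwithin.
by rewrite !dfwithout 1?eq_sym// wx// inE negb_or kj.
Qed.

End DeterminingStep.

(** The induction keeps [i] and [x] general, because the step varies both the [i]-th and the [j]-th
    coordinate over changing frozen entries. For empty [J] the only tuple is [x], whatever the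
    set. *)
Lemma exists_determining (R : realType) (X : topologicalType) (I : eqType)
    (g : (I -> X) -> R) (J : seq I) (i : I) (x : I -> X) :
  compact [set: X] -> caliber_omega1 X ->
  (forall y k, continuous (fun u => g (dfwith y k u))) ->
  uniq (i :: J) -> exists2 A, countable A & determining g J i x A.
Proof.
move=> cptX cal contg; elim: J i x => [|j J IH] i x.
  exists set0 => [|u u' eq0 y [yx _]]; first exact: countable0.
  by apply: eq0; split.
rewrite /= inE negb_or => /andP[/andP[ij iJ] /andP[jJ uJ]].
by apply: determining_cons => // z; apply: IH; rewrite /= ?iJ ?jJ.
Qed.

Lemma exists_separating_sections (R : realType) (X : topologicalType)
    (I : finType) (g : (I -> X) -> R) (i : I) :
  compact [set: X] -> caliber_omega1 X ->
  (forall y k, continuous (fun u => g (dfwith y k u))) ->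
  exists N : set (X -> R), [/\ countable N, (forall psi, N psi -> continuous psi) &
    forall u u', (forall psi, N psi -> psi u = psi u') ->
      forall y, g (dfwith y i u) = g (dfwith y i u')].
Proof.
move=> cptX cal contg.
have [[x0 _]|noX] := pselect (exists x0 : X, True); last first.
  exists set0; split => [|//|u]; first exact: countable0.
  by exfalso; apply: noX; exists u.
(* Now only the [i]-th entry is frozen, and the section overwrites it; so the base point does not
   restrict [y]. *)
pose J := rem i (enum I).
have uJ : uniq (i :: J).
  by rewrite /= mem_rem_uniqF ?enum_uniq// rem_uniq ?enum_uniq.
have [A cA dA] := @exists_determining R X I g J i (fun=> x0) cptX cal contg uJ.
exists ((fun y u => g (dfwith y i u)) @` tuples_in J (fun=> x0) A); split.
- by apply/countable_image/countable_tuples_in => //; case/andP: uJ.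
- by move=> _ [y _ <-]; exact: contg.
move=> u u' uu' y.
rewrite -(dfwith_dfwith y i x0 u) -(dfwith_dfwith y i x0 u').
apply: dA => [z zA|].
  by apply: (uu' (fun u => g (dfwith z i u))); exists z.
split=> // k; rewrite /J mem_rem_uniq ?enum_uniq// inE mem_enum andbT negbK.
by move=> /eqP ->; rewrite dfwithin.
Qed.

Lemma countable_closure (T : Type) (P : set T) (step : T -> set T) (a : T) :
  P a -> (forall x, P x -> countable (step x) /\ step x `<=` P) ->
  exists F : set T, [/\ countable F, F `<=` P, F a &
    forall x, F x -> step x `<=` F].
Proof.
move=> Pa Pstep.
pose F n := iter n (fun A => \bigcup_(x in A) step x) [set a].
have FP n : countable (F n) /\ F n `<=` P.
  elim: n => [|n [cF FP]] /=; first by split; [exact: countable1|move=> _ ->].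
  split; first by apply: bigcup_countable => // x /FP/Pstep[].
  by move=> y [x /FP/Pstep[_ +]]; apply.
exists (\bigcup_n F n); split.
- by apply: bigcup_countable => // n _; have [] := FP n.
- by move=> x [n _]; have [_] := FP n; apply.
- by exists 0%N.
- by move=> x [n _ Fx] y xy; exists n.+1 => //; exists x.
Qed.

(** The entries are exchanged one at a time; reflexivity covers an entry that has been exchanged
    before. *)
Lemma congr_tuple (I : finType) (T S : Type) (e : T -> T -> Prop)
    (g : (I -> T) -> S) : (forall u, e u u) ->
  (forall y i u u', e u u' -> g (dfwith y i u) = g (dfwith y i u')) ->
  forall x x', (forall i, e (x i) (x' i)) -> g x = g x'.
Proof.
move=> exx eg x x' xx'; pose z (s : seq I) k := if k \in s then x' k else x k.
have zE s : g x = g (z s).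
  elim: s => [//|j s ->]; rewrite -(dfwith_id (z s) j).
  have -> : z (j :: s) = dfwith (z s) j (x' j).
    apply/funext => k; rewrite /z inE; have [->|kj] := eqVneq k j.
      by rewrite dfwithin.
    by rewrite dfwithout// eq_sym.
  by apply: eg; rewrite /z; case: ifP => _; [exact: exx|exact: xx'].
rewrite (zE (enum I)); congr g; apply/funext => k.
by rewrite /z mem_enum.
Qed.

(** * The metrizable quotient *)

(** Such a [q] is a closed map: closed sets of [X] are compact, hence so are their images, which are
    then closed in [Y]. *)
Lemma compact_hausdorff_quotient (X Y Z : topologicalType) (q : X -> Y)
    (phi : Y -> Z) : compact [set: X] -> hausdorff_space Y -> continuous q ->
  (forall y, exists x, q x = y) -> continuous (phi \o q) -> continuous phi.
Proof.
move=> cX hY contq surjq /continuous_closedP contphiq.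
apply/continuous_closedP => C cC.
have -> : phi @^-1` C = q @` ((phi \o q) @^-1` C).
  apply/seteqP; split => [y Cy|_ [x Cx <-]//].
  by have [x qx] := surjq y; exists x => //=; rewrite qx.
apply: compact_closed => //; apply: continuous_compact.
  exact: continuous_subspaceT.
by apply: subclosed_compact cX _ => //; exact: contphiq.
Qed.

Section SequenceDistance.
Variable R : realType.
Implicit Types a b c : nat -> R.

(** This metric induces the product topology: the caps [k.+1%:R^-1] leave only finitely many
    coordinates to control for a given radius. *)
Definition seq_dist a b : R :=
  sup (range (fun k => Num.min k.+1%:R^-1 `|a k - b k|)).

Lemma seq_dist_ge a b k : Num.min k.+1%:R^-1 `|a k - b k| <= seq_dist a b.
Proof.
apply: ub_le_sup; last by exists k.
exists 1 => _ [n _ <-]; rewrite ge_min; apply/orP; left.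
by rewrite invf_le1// ler1n.
Qed.

Lemma seq_dist_le a b r :
  (forall k, Num.min k.+1%:R^-1 `|a k - b k| <= r) -> seq_dist a b <= r.
Proof.
move=> abr; apply: ge_sup => [|_ [k _ <-]//].
by exists (Num.min 0.+1%:R^-1 `|a 0%N - b 0%N|); exists 0%N.
Qed.

Lemma seq_distxx a : seq_dist a a = 0.
Proof.
apply/eqP; rewrite eq_le; apply/andP; split.
  by apply: seq_dist_le => k; rewrite subrr normr0 ge_min lexx orbT.
by apply: le_trans (seq_dist_ge a a 0); rewrite le_min normr_ge0 invr_ge0 ler0n.
Qed.

Lemma seq_dist_positivity a b : seq_dist a b = 0 -> a = b.
Proof.
move=> ab0; apply/funext => k; have := seq_dist_ge a b k.
rewrite ab0 ge_min invr_le0 lern0/= normr_le0 subr_eq0.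
by move=> /eqP.
Qed.

Lemma seq_dist_sym a b : seq_dist a b = seq_dist b a.
Proof.
by congr sup; apply: eq_imagel => k _; rewrite distrC.
Qed.

Lemma seq_dist_triangle b a c : seq_dist a c <= seq_dist a b + seq_dist b c.
Proof.
apply: seq_dist_le => k; apply: le_trans (lerD (seq_dist_ge a b k) (seq_dist_ge b c k)).
have := ler_distD (b k) (a k) (c k).
have : 0 <= k.+1%:R^-1 :> R by rewrite invr_ge0.
move: (k.+1%:R^-1) (normr_ge0 (a k - b k)) (normr_ge0 (b k - c k)) => e.
rewrite /Num.min; do 3 case: ifP => //; rewrite ?ltNge => *; lra.
Qed.

Lemma seq_dist_lt a e : 0 < e -> exists n, forall b,
  (forall k, (k < n)%N -> `|a k - b k| < e / 2) -> seq_dist a b < e.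
Proof.
move=> e0; exists (Num.truncn (e / 2)^-1).+1 => b ab.
apply: (@le_lt_trans _ _ (e / 2)); last by rewrite ltr_pdivrMr// ltr_pMr// ltr1n.
apply: seq_dist_le => k; rewrite ge_min; apply/orP.
have [kn|nk] := ltnP k (Num.truncn (e / 2)^-1).+1; first by right; exact/ltW/ab.
left; rewrite invf_ple ?posrE ?divr_gt0//.
apply: le_trans (ltW (truncnS_gt _)) _.
by rewrite ler_nat ltnS ltnW.
Qed.

End SequenceDistance.

(* An alias of [set_type], so that it can carry the metric [seq_dist] instead of
   the subspace topology. *)
Definition diagonal_image (R : realType) (X : Type) (h : nat -> X -> R) : Type :=
  set_type (range (fun x k => h k x)).

Section DiagonalImage.
Variables (R : realType) (X : topologicalType) (h : nat -> X -> R).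
Local Notation Y := (diagonal_image h).

HB.instance Definition _ := Choice.copy Y (set_type (range (fun x k => h k x))).

Definition diagonal_val (y : Y) : nat -> R := set_val y.

Lemma diagonal_val_inj : injective diagonal_val.
Proof. exact: val_inj. Qed.

Definition diagonal_dist (y z : Y) : R := seq_dist (diagonal_val y) (diagonal_val z).

HB.instance Definition _ := @isMetric.Build R Y diagonal_dist
  (fun y => seq_distxx _)
  (fun y z yz => diagonal_val_inj (seq_dist_positivity yz))
  (fun y z => seq_dist_sym _ _)
  (fun y x z => seq_dist_triangle _ _ _).

Definition diagonal_map (x : X) : Y :=
  @exist _ _ (fun k => h k x) (mem_set (imageP (fun x k => h k x) (I : setT x))).

Lemma diagonal_mapE x k : diagonal_val (diagonal_map x) k = h k x.
Proof. by rewrite /diagonal_val set_valE. Qed.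

Lemma eq_diagonal_map x x' :
  diagonal_map x = diagonal_map x' <-> forall k, h k x = h k x'.
Proof.
split=> [xx' k|xx']; first by rewrite -!diagonal_mapE xx'.
by apply: diagonal_val_inj; apply/funext => k; rewrite !diagonal_mapE.
Qed.

Lemma diagonal_map_surj y : exists x, diagonal_map x = y.
Proof.
have [x _ xy] := set_mem (valP y); exists x.
apply: diagonal_val_inj; apply/funext => k.
by rewrite diagonal_mapE -[RHS]/(val y k) -xy.
Qed.

Lemma continuous_diagonal_val k : continuous (fun y : Y => diagonal_val y k : R).
Proof.
move=> y; apply/(@cvgrPdist_lt _ _ _ (nbhs y)) => e e0.
(* Below the [k]-th cap the distance bounds the difference of the [k]-th coordinates itself. *)
have d0 : 0 < Num.min e k.+1%:R^-1 by rewrite lt_min e0 invr_gt0 ltr0n.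
apply: filterS (nbhsx_ballx y _ d0) => z.
rewrite ballEmdist/= /mdist/= => /(le_lt_trans (seq_dist_ge _ _ k)).
by rewrite lt_min !gt_min ltxx/= => /andP[/orP[ke yk|]//]; exact: lt_trans ke.
Qed.

Hypothesis conth : forall k, continuous (h k).

Lemma continuous_diagonal_map : continuous diagonal_map.
Proof.
move=> x; apply/metricType_numDomainType.cvgrPdist_lt => e e0.
have [n nP] := seq_dist_lt (diagonal_val (diagonal_map x)) e0.
have e20 : 0 < e / 2 by rewrite divr_gt0.
have : \forall x' \near x, forall k, (k < n)%N -> `|h k x - h k x'| < e / 2.
  elim: n {nP} => [|n IH]; first exact: nearW.
  have hn : \forall x' \near x, `|h n x - h n x'| < e / 2.
    by have /cvgrPdist_lt := @conth n x; apply.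
  apply: filterS2 IH hn => x' IH hn k; rewrite ltnS leq_eqVlt => /predU1P[->//|].
  exact: IH.
apply: filterS => x' xx'; apply: nP => k kn; rewrite !diagonal_mapE; exact: xx'.
Qed.

Lemma separable_diagonal_image : separable_space Y.
Proof.
have [D cD DP] := approximating_countable_set h.
exists (diagonal_map @` D); first exact: countable_image.
move=> O [y Oy]; rewrite openE => /(_ _ Oy); rewrite /interior.
rewrite -metricType_numDomainType.filter_from_mdist_nbhs => -[e /= e0 eO].
have [x xy] := diagonal_map_surj y.
have [n nP] := seq_dist_lt (diagonal_val y) e0.
have [|d Dd dP] := DP x n (e / 2); first by rewrite divr_gt0.
exists (diagonal_map d); split; last by exists d.
by apply: eO; apply: nP => k kn; rewrite -xy !diagonal_mapE distrC dP.
Qed.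

Lemma metrizable_diagonal_image : metrizable_space R Y.
Proof.
exists (@mdist R Y); split.
- exact: mdist_ge0.
- by move=> y z; split=> [/mdist_positivity//|->]; exact: mdistxx.
- exact: metric_sym.
- by move=> y z t; exact: metric_triangle.
- by move=> y; rewrite -metricType_numDomainType.filter_from_mdist_nbhs.
Qed.

Lemma tychonoff_diagonal_image : tychonoff_space Y.
Proof.
split; last exact: (@uniform_completely_regular R).
exact/hausdorff_accessible/(@metric_hausdorff R).
Qed.

End DiagonalImage.

(** * Factorization *)

Section SeparatingFamily.
Variables (R : realType) (E : topologicalType) (E_ : nat -> set E).
Variables (X : topologicalType) (opX : algebra_on E_ X).
Hypotheses (sigE : continuous_signature E_) (algX : semitopological_algebra opX).
Hypotheses (cptX : compact [set: X]) (cal : caliber_omega1 X).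
Hypothesis sepE : separable_space E.

(** For one [c] and [i] this is [exists_separating_sections]. Countably many [c] from a dense set
    suffice: the constants at which two values differ form an open subset of the open set [E_ n]. *)
Lemma exists_separating_operations (phi : X -> R) : continuous phi ->
  exists N : set (X -> R),
    [/\ countable N, (forall psi, N psi -> continuous psi) &
    forall u u', (forall psi, N psi -> psi u = psi u') ->
      forall n (c : E_ n) (y : 'I_n -> X) i,
        phi (opX c (dfwith y i u)) = phi (opX c (dfwith y i u'))].
Proof.
move=> contphi; have [_ op1 op2] := algX; have [_ clE _ _] := sigE.
have [D cD dD] := sepE.
have /choice[N NP] : forall t : {n : nat & (E_ n * 'I_n)%type},
    exists N : set (X -> R), [/\ countable N,
      (forall psi, N psi -> continuous psi) &
      forall u u', (forall psi, N psi -> psi u = psi u') -> forall y,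
      phi (opX (projT2 t).1 (dfwith y (projT2 t).2 u)) =
      phi (opX (projT2 t).1 (dfwith y (projT2 t).2 u'))].
  move=> [n [c i]] /=.
  apply: (@exists_separating_sections R X _ (fun y => phi (opX c y)) i) => //.
  move=> y k u; apply: (@continuous_comp _ _ _ (fun v => opX c (dfwith y k v)) phi).
    exact: op2.
  exact: contphi.
pose Dn n : set (E_ n) := [set c | D (set_val c)].
have cDn n : countable (Dn n).
  have /countable_injP[f finj] := cD; apply/countable_injP.
  exists (f \o set_val) => c c' /set_mem Dc /set_mem Dc' /finj.
  by rewrite !inE => /(_ Dc Dc')/val_inj.
exists (\bigcup_n \bigcup_(c in Dn n) \bigcup_i N (existT _ n (c, i))); split.
- apply: bigcup_countable => // n _; apply: bigcup_countable => // c _.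
  apply: bigcup_countable => [|i _]; first exact: countableP.
  by have [] := NP (existT _ n (c, i)).
- move=> psi [n _ [c _ [i _ Npsi]]].
  by have [_ + _] := NP (existT _ n (c, i)); apply.
move=> u u' uu' n c y i; apply: contrapT => /eqP ne.
have contop v : continuous (fun b : E_ n => phi (opX b (dfwith y i v))).
  move=> b; apply: (@continuous_comp _ _ _ (fun c => opX c (dfwith y i v)) phi).
    exact: op1.
  exact: contphi.
pose O := [set c : E_ n | phi (opX c (dfwith y i u)) -
                          phi (opX c (dfwith y i u')) != 0].
have : open O.
  rewrite (_ : O = (fun c => phi (opX c (dfwith y i u)) -
    phi (opX c (dfwith y i u'))) @^-1` [set r | r != 0])//.
  apply: open_comp; last exact: open_neq.
  move=> b _; apply: (@cvgB _ _ _ (nbhs b)); first exact: (contop u b).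
  exact: (contop u' b).
move=> [W oW WO].
have [||b [[Wb Eb] Db]] := dD (W `&` E_ n).
- exists (set_val c); split; last exact: set_valP.
  suff : (set_val @^-1` W) c by [].
  by rewrite WO /O/= subr_eq0.
- by apply: openI => //; have [] := clE n.
pose b' : E_ n := @exist _ _ b (mem_set Eb).
have : O b' by rewrite -WO.
rewrite /O/= subr_eq0 => /eqP; apply.
have [_ _ /= ] := NP (existT _ n (b', i)); apply => psi Npsi.
by apply: uu'; exists n => //; exists b' => //; exists i.
Qed.

(** The sequence enumerates a countable family that contains [f] and, with each [phi], the functions
    that control [phi] after every operation. *)
Lemma exists_separating_sequence (f : X -> R) : continuous f ->
  exists h : nat -> X -> R, [/\ forall k, continuous (h k),
    (exists k, h k = f) &
    forall n (c : E_ n) (x x' : 'I_n -> X),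
      (forall i k, h k (x i) = h k (x' i)) ->
      forall k, h k (opX c x) = h k (opX c x')].
Proof.
move=> contf.
have /choice[N NP] : forall phi : X -> R, exists N : set (X -> R),
    continuous phi -> [/\ countable N, (forall psi, N psi -> continuous psi) &
    forall u u', (forall psi, N psi -> psi u = psi u') ->
      forall n (c : E_ n) (y : 'I_n -> X) i,
        phi (opX c (dfwith y i u)) = phi (opX c (dfwith y i u'))].
  move=> phi; have [cphi|ncphi] := pselect (continuous phi).
    by have [N NP] := exists_separating_operations cphi; exists N.
  by exists set0 => /ncphi.
have [|F [cF FP Ff FN]] :=
  @countable_closure _ [set phi : X -> R | continuous phi] N f contf.
  by move=> phi cphi; have [cN contN _] := NP _ cphi.
have [h hF] := countable_enumeration cF Ff.
have Fh k : F (h k) by rewrite -hF; exists k.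
exists h; split => [k||n c x x' xx' k].
- exact/FP/Fh.
- by move: Ff; rewrite -hF => -[k _ <-]; exists k.
apply: (congr_tuple (e := fun u u' => forall k, h k u = h k u')
  (g := fun y => h k (opX c y))) xx' => // y i u u' uu'.
have [_ _] := NP _ (FP _ (Fh k)); apply=> psi Npsi.
by have := FN _ (Fh k) _ Npsi; rewrite -hF => -[m _ <-].
Qed.

End SeparatingFamily.

Theorem theorem15 (R : realType) (E : topologicalType) (E_ : nat -> set E)
    (X : topologicalType) (opX : algebra_on E_ X) :
  continuous_signature E_ ->
  semitopological_algebra opX ->
  compact (@setT X) ->
  caliber_omega1 X ->
  separable_space E ->
  R_factorizable R opX.
Proof.
move=> sigE algX cptX cal sepE f contf.
have [h [conth [k0 hf] hop]] :=
  exists_separating_sequence sigE algX cptX cal sepE contf.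
have [_ op1 op2] := algX.
pose Y := diagonal_image h.
pose q : X -> Y := diagonal_map h.
have contq : continuous q by exact: continuous_diagonal_map.
(* Operations on [Y] are computed on representatives chosen by [s]; by [hop] the choice does not
   affect the class of the result. *)
have [s sP] := choice (@diagonal_map_surj R X h).
pose opY : algebra_on E_ Y := fun n c y => q (opX n c (s \o y)).
have homq : algebra_hom opX opY q.
  move=> n c x; apply/eq_diagonal_map; apply: hop => i.
  by apply/eq_diagonal_map; rewrite /= sP.
exists Y, opY, (fun y => diagonal_val y k0), q; split; split.
- split; first exact: tychonoff_diagonal_image.
    move=> n y c; apply: (@continuous_comp _ _ _ (fun c => opX n c (s \o y)) q).
      exact: op1.
    exact: contq.
  (* Continuity in an argument from [Y] is tested after composing with [q], where it reduces to
     separate continuity on [X]. *)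
  move=> n c y i; apply: (@compact_hausdorff_quotient X _ _ q) => //.
  - exact: (@metric_hausdorff R).
  - exact: diagonal_map_surj.
  have -> : (fun v => opY n c (dfwith y i v)) \o q =
      q \o (fun u => opX n c (dfwith (s \o y) i u)).
    apply/funext => u /=; rewrite homq; congr (opY n c).
    apply/funext => k; have [->|ki] := eqVneq k i.
      by rewrite /= !dfwithin.
    by rewrite /= !dfwithout 1?eq_sym//= sP.
  by move=> u; apply: continuous_comp; [exact: op2|exact: contq].
- exact: separable_diagonal_image.
- exact: metrizable_diagonal_image.
- exact: continuous_diagonal_val.
- exact: contq.
- exact: homq.
- by apply/funext => x; rewrite /= diagonal_mapE hf.
Qed.
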